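(* Let $k \geq 2$, $0 \leq j \leq k-1$, and $n = a(k+1) + r \geq 0$ with integers $a$ and $r$, $-1 \leq r \leq k-1$. (i) If $r=0$, $j \geq 1$ and $a$ is odd, then $v_2(B_n(k,j)) = 1$. (ii) If $r=0$, $1 \leq j \leq k-2$, $a$ is even and $v_2(a) \leq k$, then $v_2(B_n(k,j)) = 1+ v_2(a)$. (iii) If $r=1$, $j \geq 2$, $a$ is odd and $v_2(a+1) \leq k+1$, then $v_2(B_n(k,j)) = 1+ v_2(a+1)$. (iv) If $r=1$, $j \geq 2$, $a$ is even and $v_2(a) \leq k+1$, then $v_2(B_n(k,j)) = 1+ v_2(a)$. (v) If $r=1$, $j=0$ and $a$ is odd, then $v_2(B_n(k,j)) = 1$. (vi) If $r=j+1 \leq k-1$, $j\geq 1$ and $v_2(a) \leq k$, then $v_2(B_n(k,j)) = 1 + v_2(a)$.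
   Context: For integers $k \geq 2$ and $0 \leq j \leq k-1$, the sequence $\{B_n(k,j)\}_{n\geq 0}$ is defined by the recurrence $B_n(k,j) = B_{n-1}(k,j) + B_{n-2}(k,j)+\dots+B_{n-k}(k,j)$ for all $n \geq k$, with initial values $B_j(k,j)=1$ and $B_i(k,j)=0$ for $0 \leq i \leq k-1$, $i \neq j$. $v_2$ denotes the 2-adic order (2-adic valuation), with the convention $v_2(0)=+\infty$ (so a hypothesis such as $v_2(a) \leq k$ excludes $a=0$). *)

(* Defs.v *)
From HB Require Import structures.
From mathcomp Require Import all_boot all_order all_algebra.
From mathcomp Require Import zify.
From mathcomp Require Import constructive_ereal.

Set Implicit Arguments.
Unset Strict Implicit.
Unset Printing Implicit Defensive.

(* [kbon_prefix k j n] is the list [:: B_0(k,j); ...; B_(n-1)(k,j)]. *)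
Fixpoint kbon_prefix (k j n : nat) : seq nat :=
  if n is m.+1 then
    let s := kbon_prefix k j m in
    rcons s (if m < k then nat_of_bool (m == j)
             else \sum_(1 <= i < k.+1) nth 0 s (m - i))
  else [::].

(* B_n(k,j), characterized by [kbon_init] and [kbon_rec] below. *)
Definition kbon (k j n : nat) : nat := nth 0 (kbon_prefix k j n.+1) n.

Lemma size_kbon_prefix k j n : size (kbon_prefix k j n) = n.
Proof. by elim: n => //= n IHn; rewrite size_rcons IHn. Qed.

Lemma nth_kbon_prefix k j n m : m < n -> nth 0 (kbon_prefix k j n) m = kbon k j m.
Proof.
elim: n => // n IHn; rewrite ltnS leq_eqVlt => /predU1P[-> //|lt_mn].
by rewrite /= nth_rcons size_kbon_prefix lt_mn IHn.
Qed.

Lemma kbon_init k j n : n < k -> kbon k j n = (n == j).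
Proof.
by move=> lt_nk; rewrite /kbon /= nth_rcons size_kbon_prefix ltnn eqxx lt_nk.
Qed.

Lemma kbon_rec k j n : 0 < k <= n ->
  kbon k j n = \sum_(1 <= i < k.+1) kbon k j (n - i).
Proof.
move=> /andP[k_gt0 le_kn].
rewrite /kbon /= nth_rcons size_kbon_prefix ltnn eqxx ltnNge le_kn /=.
apply: eq_big_nat => i /andP[i_gt0 le_ik]; apply: nth_kbon_prefix; lia.
Qed.

(* 2-adic valuation, with values in the extended integers [\bar int];
   [logn 2 0 = 0], hence the separate case giving v_2(0) = +oo. *)
Definition v2 (z : int) : \bar int :=
  if z == 0%R then (+oo)%E else ((logn 2 `|z|%N)%:Z%:E)%E.

(* Main.v *)
(** Multiplying the characteristic polynomial by [x - 1] turns the recurrence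
    into [B_(m+k+1) = 2 B_(m+k) - B_m].  In terms of the shift operator [E]
    this reads [- E^(k+1) = 1 - 2 E^k], so expanding the [a]-th power gives
    [(-1)^a B_(a(k+1)+r) = \sum_i 'C(a, i) (-2)^i B_(ki+r)].
    As [i 'C(a, i) = a 'C(a-1, i-1)], the terms with [i >= 3] are divisible by
    [2^(v_2(a)+2)].  Hence if [B_r = 0], the valuation of the sum is
    [1 + v_2(a)] as soon as [B_(k+r) + (a-1) B_(2k+r)] is odd, and each case
    reduces to such a parity, which is easy since [B] has period [k+1] mod 2.
    In case (iii) this is applied to [a+1] and to the sequence extended to
    indices [>= -k]. *)
Require Import Defs.
From mathcomp Require Import all_boot all_order all_algebra.
From mathcomp Require Import zify ring.
From mathcomp Require Import constructive_ereal.

Import GRing.Theory.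

Local Open Scope ring_scope.

Lemma v2_nat (n : nat) : (0 < n)%N -> v2 n%:Z = ((logn 2 n)%:Z)%:E.
Proof. by case: n. Qed.

(** The exponent of the modulus is one more than v_2(2a), so [z] and 2a have the same valuation. *)
Lemma v2_eq_add1 (z : int) (a : nat) : (0 < a)%N ->
  ((2 ^ (logn 2 a).+2)%N%:Z %| z - (2 * a)%N%:Z)%Z -> v2 z = (1 + v2 a%:Z)%E.
Proof.
move=> a_gt0; rewrite v2_nat //; set e := logn 2 a => dvd_z.
have dvd_le f : (f <= e.+2)%N -> (2 ^ f %| `|z|)%N = (f <= e.+1)%N.
  move=> le_fe.
  have -> : (2 ^ f %| `|z|)%N = ((2 ^ f)%N%:Z %| z)%Z by [].
  rewrite -[z](subrK (2 * a)%N%:Z) rpredDl.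
    by rewrite dvdzE /= pfactor_dvdn ?muln_gt0 // lognM // logn_prime // add1n.
  by apply: dvdz_trans dvd_z; rewrite dvdzE /= dvdn_exp2l.
have z_neq0 : z != 0.
  by apply/eqP=> z0; move: (dvd_le e.+2 (leqnn _)); rewrite z0 dvdn0 ltnn.
have z_gt0 : (0 < `|z|)%N by rewrite absz_gt0.
rewrite /v2 (negPf z_neq0).
suff -> : logn 2 `|z| = e.+1 by rewrite -add1n PoszD.
apply/eqP; rewrite eqn_leq -ltnS ltnNge -!pfactor_dvdn //.
by rewrite !dvd_le ?ltnn ?leqnn.
Qed.

Lemma dvdn_exp2_bin (a i : nat) : (0 < a)%N -> (2 < i)%N ->
  (2 ^ (logn 2 a).+2 %| 2 ^ i * 'C(a, i))%N.
Proof.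
move=> a_gt0 i_gt2; have [/bin_small->|le_ia] := ltnP a i; first by rewrite muln0.
have C_gt0 : (0 < 'C(a, i))%N by rewrite bin_gt0.
have i_gt0 : (0 < i)%N by lia.
rewrite pfactor_dvdn ?muln_gt0 ?expn_gt0 // lognM ?expn_gt0 // pfactorK //.
have le_a : (logn 2 a <= logn 2 i + logn 2 'C(a, i))%N.
  rewrite -lognM // dvdn_leq_log ?muln_gt0 ?i_gt0 //.
  by rewrite -(prednK i_gt0) -mul_bin_diag dvdn_mulr.
(* As [2 ^ logn 2 i] divides [i], it suffices that i < 2^(i-1), true from i = 3 on. This yields the
   extra factor 4. *)
have lt_i : (logn 2 i < i.-1)%N.
  rewrite -(ltn_exp2l _ _ (isT : 1 < 2)%N).
  apply: leq_ltn_trans (dvdn_leq i_gt0 (pfactor_dvdnn 2 i)) _.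
  elim: i i_gt2 {le_ia C_gt0 i_gt0 le_a} => // [[|[|[|i]]]] // IHi _.
  by rewrite /= expnS; have /= := IHi isT; lia.
lia.
Qed.

(** Values are integers because the backward extension of [kbon] takes negative values. *)
Definition shift_rec (k : nat) (u : nat -> int) :=
  forall m, u (m + k.+1)%N = 2 * u (m + k)%N - u m.

(** Induction on [a] for all [r] at once: one step brings in the offsets [r] and [r + k], and
    Pascal's rule merges the two expansions. *)
Lemma shift_expansion (k : nat) (u : nat -> int) (a r : nat) : shift_rec k u ->
  (-1) ^+ a * u (a * k.+1 + r)%N =
  \sum_(i < a.+1) (-2) ^+ i * 'C(a, i)%:Z * u (k * i + r)%N.
Proof.
move=> u_rec; elim: a r => [|a IHa] r.
  by rewrite big_ord1 !expr0 bin0 muln0 mul0n.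
have -> : (a.+1 * k.+1 + r = (a * k.+1 + r) + k.+1)%N by lia.
rewrite u_rec -addnA exprS.
transitivity (-2 * ((-1) ^+ a * u (a * k.+1 + (r + k))%N)
              + (-1) ^+ a * u (a * k.+1 + r)%N); first ring.
rewrite !IHa [RHS]big_ord_recl /=.
under [in RHS]eq_bigr => i _.
  rewrite /bump /= add1n binS PoszD mulrDr mulrDl; over.
rewrite big_split /= addrA [LHS]addrC; congr (_ + _).
  rewrite big_ord_recl /= bin0; congr (_ + _).
  rewrite [RHS]big_ord_recr /= bin_small // mulr0 mul0r addr0.
  by apply: eq_bigr => i _; rewrite /bump /= add1n.
rewrite mulr_sumr; apply: eq_bigr => i _.
by rewrite (_ : k * i + (r + k) = k * i.+1 + r)%N ?exprS; [ring | lia].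
Qed.

Lemma shift_congruence (k : nat) (u : nat -> int) (a r : nat) : shift_rec k u ->
  (0 < a)%N ->
  ((2 ^ (logn 2 a).+2)%N%:Z %| (-1) ^+ a * u (a * k.+1 + r)%N
     - (u r - 2 * a%:Z * (u (k + r)%N - (a%:Z - 1) * u (k.*2 + r)%N)))%Z.
Proof.
move=> u_rec a_gt0; set d := (2 ^ _)%N%:Z.
pose F i := (-2) ^+ i * 'C(a, i)%:Z * u (k * i + r)%N.
have F_dvd i : (2 < i)%N -> (d %| F i)%Z.
  move=> i_gt2; apply: dvdz_mulr.
  by rewrite dvdzE abszM abszX dvdn_exp2_bin.
have F012 : F 0%N + F 1%N + F 2%N
    = u r - 2 * a%:Z * (u (k + r)%N - (a%:Z - 1) * u (k.*2 + r)%N).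
  have bin2Z : 2 * 'C(a, 2)%:Z = a%:Z * (a%:Z - 1).
    by have := mul_bin_diag a 1; rewrite bin1; nia.
  rewrite /F bin0 bin1 muln0 muln1 muln2 expr2.
  have -> : -2 * -2 * 'C(a, 2)%:Z = 2 * (2 * 'C(a, 2)%:Z) by ring.
  by rewrite bin2Z; ring.
rewrite shift_expansion // -F012.
(* Padding with zero binomials lets the terms 0, 1, 2 be split off even when [a] is 1. *)
have -> : \sum_(i < a.+1) F i = \sum_(0 <= i < a.+3) F i.
  rewrite -(big_mkord xpredT) (@big_cat_nat _ _ _ a.+1 0 a.+3) //=; last by lia.
  rewrite [X in _ + X]big_nat [X in _ + X]big1 ?addr0 // => i /andP[lt_ai _].
  by rewrite /F bin_small // mulr0 mul0r.
do 3 rewrite big_ltn //.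
rewrite !addrA addrC addrK.
by rewrite big_nat; apply: rpred_sum => i /andP[/F_dvd].
Qed.

Lemma v2_shift (k : nat) (u : nat -> int) (a r : nat) : shift_rec k u ->
  (0 < a)%N -> u r = 0 ->
  ~~ (2 %| u (k + r)%N + (a%:Z - 1) * u (k.*2 + r)%N)%Z ->
  v2 (u (a * k.+1 + r)%N) = (1 + v2 a%:Z)%E.
Proof.
move=> u_rec a_gt0 ur0 odd_c.
have := shift_congruence k u a r u_rec a_gt0; rewrite ur0 sub0r opprK.
set d := (2 ^ _)%N%:Z; set c := _ - _ => dvd_d.
have v2N x : v2 ((-1) ^+ a * x) = v2 x.
  by rewrite /v2 mulf_eq0 signr_eq0 abszMsign.
rewrite -v2N; apply: v2_eq_add1 => //.
(* Since [c] is odd, 2ac is congruent to -2a modulo [d], so the signed term is congruent to 2a. *)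
have dvd_2a : (d %| 2 * a%:Z * (c + 1))%Z.
  have -> : d = 2 * (2 ^ logn 2 a)%N%:Z * 2 by rewrite /d !expnS; lia.
  apply: dvdz_mul; last by move: odd_c; rewrite /c; lia.
  by apply: (dvdz_mul (dvdzz 2)); rewrite dvdzE; apply: pfactor_dvdnn.
by have := rpredB dvd_d dvd_2a; rewrite -/d (mulrDr _ c) mulr1 opprD addrA addrK PoszM.
Qed.

(** The sums giving B_(n+1) and B_n differ only in their end terms B_n and B_(n-k). *)
Lemma kbon_shift (k j n : nat) : (0 < k <= n)%N ->
  (kbon k j n.+1 + kbon k j (n - k) = 2 * kbon k j n)%N.
Proof.
move=> /andP[k_gt0 le_kn]; rewrite mul2n -addnn.
rewrite {1}kbon_rec; last lia.
rewrite big_ltn // subn1 big_add1 /= -addnA; congr addn.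
by rewrite [RHS]kbon_rec ?k_gt0 // big_nat_recr.
Qed.

Lemma kbon_kk (k j : nat) : (j < k)%N -> kbon k j k = 1%N.
Proof.
move=> lt_jk; rewrite kbon_rec; last lia.
rewrite (bigD1_seq (k - j)%N) ?mem_index_iota ?iota_uniq //=; last lia.
rewrite kbon_init; last lia.
rewrite subKn ?(ltnW lt_jk) // eqxx big_nat_cond big1 // => i i_range.
by rewrite kbon_init; lia.
Qed.

Lemma kbon_shift_rec (k j : nat) : (0 < k)%N ->
  shift_rec k (fun m => (kbon k j m)%:Z).
Proof.
move=> k_gt0 m; have := kbon_shift k j (m + k); rewrite addnK -addnS; lia.
Qed.

(* The term of index [m] is [B_(m-k)], negative indices being reached by
   running the recurrence backwards. *)
Lemma kbon_ext_shift_rec (k j : nat) : (0 < k)%N ->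
  shift_rec k (fun m => if (m < k)%N then 2 * (kbon k j m)%:Z - (kbon k j m.+1)%:Z
                        else (kbon k j (m - k))%:Z).
Proof.
move=> k_gt0 m; rewrite -addSnnS !ltnNge !leq_addl /= -ltnNge.
rewrite !addnK; case: ltnP => [_|le_km]; first ring.
by have := kbon_shift k j m; lia.
Qed.

Lemma odd_kbon_shift (k j m : nat) : (0 < k)%N ->
  odd (kbon k j (m + k.+1)) = odd (kbon k j m).
Proof. by move=> k_gt0; have := kbon_shift_rec k j k_gt0 m; lia. Qed.

Theorem theorem7 (k j n : nat) (a r : int)
    (hk : (2 <= k)%N) (hj : (j <= k - 1)%N)
    (hn : n%:Z = a * (k%:Z + 1) + r)
    (hr : -1 <= r <= k%:Z - 1) :
  (r = 0 -> (1 <= j)%N -> ~~ (2 %| a)%Z -> v2 (kbon k j n)%:Z = 1%E)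
  /\
  (r = 0 -> (1 <= j)%N -> (j <= k - 2)%N -> (2 %| a)%Z ->
     (v2 a <= k%:Z%:E)%E -> v2 (kbon k j n)%:Z = (1 + v2 a)%E)
  /\
  (r = 1 -> (2 <= j)%N -> ~~ (2 %| a)%Z ->
     (v2 (a + 1)%R <= (k%:Z + 1)%:E)%E ->
     v2 (kbon k j n)%:Z = (1 + v2 (a + 1)%R)%E)
  /\
  (r = 1 -> (2 <= j)%N -> (2 %| a)%Z ->
     (v2 a <= (k%:Z + 1)%:E)%E -> v2 (kbon k j n)%:Z = (1 + v2 a)%E)
  /\
  (r = 1 -> j = 0%N -> ~~ (2 %| a)%Z -> v2 (kbon k j n)%:Z = 1%E)
  /\
  (r = j%:Z + 1 -> j%:Z + 1 <= k%:Z - 1 -> (1 <= j)%N ->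
     (v2 a <= k%:Z%:E)%E -> v2 (kbon k j n)%:Z = (1 + v2 a)%E).
Proof.
have k_gt0 : (0 < k)%N by lia.
have lt_jk : (j < k)%N by lia.
(* From n >= 0 and r < k+1 follows a(k+1) > -(k+1), hence a >= 0. *)
have [a' a_eq] : exists a' : nat, a = a'%:Z by exists `|a|%N; nia.
subst a; move: a' hn => a hn.
have v2_neq0 (x m : int) : (v2 x <= m%:E)%E -> x != 0.
  by apply: contraTN => /eqP ->; rewrite /v2 eqxx.
have v2_odd : ~~ (2 %| a%:Z)%Z -> (1 + v2 a%:Z)%E = 1%E.
  move=> odd_a; rewrite v2_nat; last lia.
  have a_odd : odd a by lia.
  by rewrite lognE dvdn2 a_odd !andbF.
(* The parity condition of [v2_shift], where [~~ odd a] is the parity of a-1. *)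
have v2_kbon (s : nat) : r = s%:Z -> (0 < a)%N -> kbon k j s = 0%N ->
    odd (kbon k j (k + s)) (+) (~~ odd a && odd (kbon k j (k.*2 + s))) ->
    v2 (kbon k j n)%:Z = (1 + v2 a%:Z)%E.
  move=> r_eq a_gt0 ks0 odd_s.
  have -> : n = (a * k.+1 + s)%N by lia.
  apply: (v2_shift k _ a s (kbon_shift_rec k j k_gt0)) => //; first by rewrite ks0.
  move: odd_s; rewrite (_ : ~~ odd a = odd a.-1) -?oddM -?oddD; last lia.
  by rewrite (_ : a%:Z - 1 = a.-1%:Z) -?PoszM -?PoszD; lia.
have kk := kbon_kk k j lt_jk.
have kSk : (kbon k j k.+1 + kbon k j 0 = 2)%N.
  by have := kbon_shift k j k; rewrite kk subnn => ->; rewrite // k_gt0 leqnn.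
have k0 : kbon k j 0 = (0 == j)%N by rewrite kbon_init.
have k1 : kbon k j 1 = (1 == j)%N by rewrite kbon_init.
split=> [r0 j_gt0 odd_a|].
  rewrite (v2_kbon 0) ?v2_odd ?addn0 ?k0 ?kk //; lia.
split=> [r0 j_gt0 lt_j2 even_a /v2_neq0 a_neq0|].
  apply: (v2_kbon 0); rewrite ?addn0 ?k0 ?kk //; try lia.
  (* B_(2k) has the parity of B_(k-1), which is 0 as j <= k-2. *)
  have := odd_kbon_shift k j k.-1 k_gt0; rewrite (@kbon_init _ _ k.-1); last lia.
  by rewrite (_ : k.-1 + k.+1 = k.*2)%N; lia.
split=> [r1 j_gt1 odd_a _|].
  have -> : a%:Z + 1 = a.+1%:Z by lia.
  (* With r = 1, n + k = (a+1)(k+1), so B_n is the extended term at offset 0. The term of index 0 is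
     2 B_0 - B_1 = 0 as j >= 2. *)
  rewrite -(v2_shift k _ a.+1 0 (kbon_ext_shift_rec k j k_gt0)) //.
  - have -> : (a.+1 * k.+1 + 0 = n + k)%N by lia.
    by rewrite ltnNge leq_addl addnK.
  - by rewrite k_gt0 k0 k1; lia.
  rewrite !addn0 ltnn -addnn ltnNge leq_addl /= addnK subnn kk k0; lia.
split=> [r1 j_gt1 even_a /v2_neq0 a_neq0|].
  apply: (v2_kbon 1) => //; rewrite ?k1 ?addn1; try lia.
  (* B_(k+1) = 2 is even, while B_(2k+1) has the parity of B_k = 1 and a-1 is odd. *)
  have := odd_kbon_shift k j k k_gt0.
  by rewrite kk (_ : k + k.+1 = k.*2.+1)%N; lia.
split=> [r1 j0 odd_a|r_eq lt_j1k j_gt0 /v2_neq0 a_neq0].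
  rewrite (v2_kbon 1) ?v2_odd //; rewrite ?k1 ?addn1; lia.
apply: (v2_kbon j.+1); [lia | lia | rewrite kbon_init; lia |].
(* Modulo 2, B_(k+j+1) is B_j = 1 and B_(2k+j+1) is B_(j-1) = 0, whatever the parity of [a]. *)
have := odd_kbon_shift k j j k_gt0; rewrite (kbon_init _ lt_jk) eqxx.
have := odd_kbon_shift k j (j.-1 + k.+1) k_gt0.
rewrite (odd_kbon_shift k j j.-1) // (@kbon_init _ _ j.-1); last lia.
rewrite (_ : j + k.+1 = k + j.+1)%N; last lia.
rewrite (_ : j.-1 + k.+1 + k.+1 = k.*2 + j.+1)%N; last lia.
have -> : (j.-1 == j) = false by lia.
by move=> -> ->; rewrite andbF.
Qed.
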